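(* Let $\Omega\subset\mathbb{R}^d$ be a nonempty compact convex set, let $\xi$ be a random variable with law $P$, and let $f:\mathbb{R}^d\to\mathbb{R}$, $f(x)=\mathbb{E}_\xi[f(x,\xi)]$, be convex and $L$-smooth on $\mathbb{R}^d$. Assume access to an unbiased stochastic first order oracle: $\mathbb{E}[\nabla f(x,\xi)]=\nabla f(x)$ for every $x\in\mathbb{R}^d$, where $\xi\sim P$. Let $x^*\in\operatorname{argmin}_{x\in\Omega}f(x)$. Let $(x_k)_{k\ge 0}$ be generated by the algorithm FW-SDA (Stochastic Frank-Wolfe with Dual Averaging, described in the context) with step sizes $\alpha_k=\frac{2}{k+1}$ for $k\ge1$, with parameters $\beta_k$ satisfying $$\alpha_k=\frac{\beta_k}{\sum_{i=1}^k\beta_i}\qquad\text{for all }k\ge 1,$$ and with sample sizes $p_k$ chosen such that, for every $k\ge1$ and every $x\in\mathbb{R}^d$, $$\mathbb{E}\big[\|\nabla_k(x)-\nabla f(x)\|\big]\le\frac1k,\qquad \nabla_k(x):=\frac1{p_k}\sum_{j=1}^{p_k}\nabla f(x,\xi_j),$$ where $\xi_1,\dots,\xi_{p_k}$ are the i.i.d. samples drawn from $P$ at iteration $k$. Then $$\mathbb{E}[f(x_k)-f(x^* )]=\mathcal{O}\Big(\frac1k\Big),$$ i.e. there is a constant $C$ independent of $k$ such that $\mathbb{E}[f(x_k)-f(x^* )]\le C/k$ for all $k\ge1$.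
   Context: $\|\cdot\|$ is the Euclidean norm and $\langle\cdot,\cdot\rangle$ the Euclidean inner product. A function is $L$-smooth if it is differentiable and $\|\nabla f(x)-\nabla f(y)\|\le L\|x-y\|$ for all $x,y\in\mathbb{R}^d$. $\nabla f(x,\xi)$ denotes the stochastic gradient (with respect to $x$) returned by the oracle at $x$ for the sample $\xi$; it is assumed jointly measurable in $(x,\xi)$. Algorithm FW-SDA. Input: initial point $x_0\in\Omega$ (deterministic), real parameters $\alpha_k$, $\beta_k$ (with nonzero partial sums $\sum_{i=1}^k\beta_i$), and positive integers $p_k$, $k\ge1$. Initialize $w_0\in\operatorname{argmin}_{x\in\Omega}\langle\nabla f(x_0),x\rangle$ and $g_0=0$. For $k=1,2,\dots$: 1. $z_{k-1}=(1-\alpha_k)x_{k-1}+\alpha_k w_{k-1}$. 2. Draw $p_k$ i.i.d. samples $\xi_1,\dots,\xi_{p_k}$ from $P$, independent of the past history $\mathcal{F}_{k-1}$ (the $\sigma$-algebra generated by all samples drawn in iterations $1,\dots,k-1$), and set $\nabla_k(z_{k-1})=\frac1{p_k}\sum_{j=1}^{p_k}\nabla f(z_{k-1},\xi_j)$. 3. $g_k=\frac{1}{\sum_{i=1}^k\beta_i}\Big\{\big(\sum_{i=1}^{k-1}\beta_i\big)g_{k-1}+\beta_k\nabla_k(z_{k-1})\Big\}$. 4. Choose $w_k\in\operatorname{argmin}_{x\in\Omega}\langle g_k,x\rangle$ (any minimizer, selected so that $w_k$ is $\mathcal{F}_k$-measurable). 5. $x_k=(1-\alpha_k)x_{k-1}+\alpha_k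 w_k$. *)

(* Defs.v *)
(* MathComp-Analysis development: R is an arbitrary [realType] and R^d is
   ['rV[R]_d]. *)
From HB Require Import structures.
From mathcomp Require Import all_boot all_order all_algebra.
From mathcomp Require Import all_classical all_reals all_analysis.

Set Implicit Arguments.
Unset Strict Implicit.
Unset Printing Implicit Defensive.

Import Order.TTheory GRing.Theory Num.Theory.
Import numFieldNormedType.Exports.

Local Open Scope classical_set_scope.
Local Open Scope ring_scope.

(* The library gives row vectors no sigma-algebra; we equip them with the Borel
   sigma-algebra of their (unique Hausdorff vector space) topology. *)
Definition rV_borel_display (R : realType) (d : nat) : measure_display :=
  sigma_display (@open 'rV[R]_d).

Section rV_borel.
Variables (R : realType) (d : nat).

Let rV_borel : set (set 'rV[R]_d) := <<s @open 'rV[R]_d >>.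

HB.instance Definition _ := @isMeasurable.Build (rV_borel_display R d)
  'rV[R]_d rV_borel (@sigma_algebra0 _ setT _) (@sigma_algebraC _ _)
  (@sigma_algebra_bigcup _ setT _).

End rV_borel.

Section euclidean.
Variables (R : realType) (d : nat).
Implicit Types (x y : 'rV[R]_d) (f : 'rV[R]_d -> R) (Omega : set 'rV[R]_d).

Definition dotp x y : R := \sum_(i < d) x ord0 i * y ord0 i.

(* The norm [`|x|] of the library is the sup norm, hence this definition. *)
Definition enorm x : R := Num.sqrt (dotp x x).

(* The vector of partial derivatives; it is the gradient only at points where
   [f] is differentiable, so it is always used together with [smooth]. *)
Definition grad f x : 'rV[R]_d := \row_(i < d) 'D_(delta_mx ord0 i) f x.

(* [differentiable] refers to the sup norm, but in finite dimension it does not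
   depend on the choice of the norm. *)
Definition smooth (L : R) f : Prop :=
  (forall x, differentiable f x) /\
  (forall x y, enorm (grad f x - grad f y) <= L * enorm (x - y)).

Definition argmin Omega f : set 'rV[R]_d :=
  [set x | Omega x /\ forall y, Omega y -> f x <= f y].

End euclidean.

Section independence.
Context {dT dS : measure_display} {T : measurableType dT}
  {S : measurableType dS} {R : realType}.
Variable Pr : probability T R.

Definition independent_systems (F G : set (set T)) : Prop :=
  forall A B, F A -> G B -> Pr (A `&` B) = (Pr A * Pr B)%E.

(* The product rule for subfamilies is the case where some [B j] are [setT]. *)
Definition mutually_independent (n : nat) (X : nat -> T -> S) : Prop :=
  forall B : nat -> set S, (forall j, measurable (B j)) ->
    Pr (\bigcap_(j in `I_n) (X j @^-1` B j)) =
    (\prod_(j < n) Pr (X j @^-1` B j))%E.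

End independence.

Section sampling.
Context {dT dS : measure_display} {T : measurableType dT}
  {S : measurableType dS} {R : realType}.
Variables (Pr : probability T R) (P : probability S R).
(* [xi k j] with [j < p k] is the sample number [j] (counted from 0) of
   iteration [k >= 1]; all the other values of [xi] are irrelevant. *)
Variables (p : nat -> nat) (xi : nat -> nat -> {RV Pr >-> S}).

Definition batch_sigma (k : nat) : set (set T) :=
  <<s \bigcup_(j in `I_(p k)) preimage_set_system [set: T] (xi k j) measurable >>.

Definition history (k : nat) : set (set T) :=
  <<s \bigcup_(i in [set i | (1 <= i <= k)%N]) \bigcup_(j in `I_(p i))
        preimage_set_system [set: T] (xi i j) measurable >>.

Record fresh_iid_samples : Prop := FreshIidSamples {
  sample_law : forall k j A, (1 <= k)%N -> (j < p k)%N -> measurable A ->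
    distribution Pr (xi k j) A = P A ;
  sample_indep : forall k, (1 <= k)%N ->
    mutually_independent Pr (p k) (fun j => xi k j) ;
  sample_fresh : forall k, (1 <= k)%N ->
    independent_systems Pr (history k.-1) (batch_sigma k)
}.

End sampling.

Section oracle.
Context {dS : measure_display} {S : measurableType dS} {R : realType} {d : nat}.
Variable P : probability S R.

(* [f x = E[F(x, xi)]] for [xi] of law [P]; integrability makes the expectation
   meaningful. *)
Definition is_mean_of (F : 'rV[R]_d -> S -> R) (f : 'rV[R]_d -> R) : Prop :=
  forall x, P.-integrable [set: S] (EFin \o F x) /\ ('E_P[F x] = (f x)%:E)%E.

(* [G x s] is the answer of the oracle at [x] for the sample [s]; the
   expectation of a random vector is taken coordinatewise. *)
Record unbiased_oracle (G : 'rV[R]_d -> S -> 'rV[R]_d) (f : 'rV[R]_d -> R)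
    : Prop := UnbiasedOracle {
  oracle_measurable :
    measurable_fun [set: 'rV[R]_d * S] (fun xs : 'rV[R]_d * S => G xs.1 xs.2) ;
  oracle_integrable : forall x i,
    P.-integrable [set: S] (fun s => (G x s ord0 i)%:E) ;
  oracle_unbiased : forall x i,
    ('E_P[fun s => G x s ord0 i] = (grad f x ord0 i)%:E)%E
}.

End oracle.

Section FW_SDA.
Context {dT dS : measure_display} {T : measurableType dT}
  {S : measurableType dS} {R : realType} {d : nat}.
Variables (Pr : probability T R) (P : probability S R).
Variables (Omega : set 'rV[R]_d) (f : 'rV[R]_d -> R).
Variable G : 'rV[R]_d -> S -> 'rV[R]_d.
Variables (alpha beta : nat -> R) (p : nat -> nat).
Variable xi : nat -> nat -> {RV Pr >-> S}.

Definition minibatch (k : nat) (x : 'rV[R]_d) (t : T) : 'rV[R]_d :=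
  (p k)%:R^-1 *: \sum_(j < p k) G x (xi k j t).

Definition beta_sum (k : nat) : R := \sum_(1 <= i < k.+1) beta i.

(* Iteration [k >= 1] of the algorithm is indexed here by [k.+1], so that
   [z k] is the point at which the minibatch of iteration [k.+1] is
   evaluated. *)
Record FW_SDA (x0 : 'rV[R]_d) (x w z g : nat -> T -> 'rV[R]_d) : Prop := FwSda {
  sda_x0_in : Omega x0 ;
  sda_beta_sum : forall k, (1 <= k)%N -> beta_sum k != 0 ;
  sda_p_gt0 : forall k, (1 <= k)%N -> (0 < p k)%N ;
  sda_samples : fresh_iid_samples P p xi ;
  sda_x0 : forall t, x 0%N t = x0 ;
  sda_w0 : exists2 w0, argmin Omega (dotp (grad f x0)) w0 &
                       forall t, w 0%N t = w0 ;
  sda_g0 : forall t, g 0%N t = 0 ;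
  sda_z : forall k t,
    z k t = (1 - alpha k.+1) *: x k t + alpha k.+1 *: w k t ;
  sda_g : forall k t,
    g k.+1 t = (beta_sum k.+1)^-1 *:
      (beta_sum k *: g k t + beta k.+1 *: minibatch k.+1 (z k t) t) ;
  sda_w : forall k t, argmin Omega (dotp (g k.+1 t)) (w k.+1 t) ;
  sda_w_measurable : forall k,
    preimage_set_system [set: T] (w k.+1) measurable `<=` history p xi k.+1 ;
  sda_x : forall k t,
    x k.+1 t = (1 - alpha k.+1) *: x k t + alpha k.+1 *: w k.+1 t
}.

End FW_SDA.

(* Main.v *)
(* With weights [k] and [A k = k (k + 1) / 2] the averaged gradients are
   [g k = (A k)^-1 \sum_(i <= k) i * grad_i], so [w k] minimizes over [Omega] the
   sum [psi k] of the weighted stochastic linearizations of [f] at the points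
   [z i].  The descent inequality at [z], convexity, and "be the leader" for
   [psi] telescope to the pathwise bound
   [A k (f (x k) - f xstar) <= \sum_(i <= k) (2 L D^2 + 2 D i |err_i|)], where [D]
   is the diameter of [Omega].  The point [z] at which the minibatch of iteration
   [i] is evaluated is independent of that minibatch, so [E|err_i| <= 1 / i] by
   Fubini; the sum is then linear in [k] and [A k] is quadratic. *)
Require Import Defs.
From HB Require Import structures.
From mathcomp Require Import all_boot all_order all_algebra.
From mathcomp Require Import all_classical all_reals all_analysis.
From mathcomp Require Import measurable_realfun ring lra.

Set Implicit Arguments.
Unset Strict Implicit.
Unset Printing Implicit Defensive.

Import Order.TTheory GRing.Theory Num.Theory.
Import numFieldNormedType.Exports.

Local Open Scope classical_set_scope.
Local Open Scope ring_scope.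

(** * Euclidean inner product and norm *)

Section euclidean_theory.
Context {R : realType} {d : nat}.
Implicit Types (x y z : 'rV[R]_d) (a : R).

Lemma dotpC x y : dotp x y = dotp y x.
Proof. by apply: eq_bigr => i _; rewrite mulrC. Qed.

Lemma dotpDr x y z : dotp x (y + z) = dotp x y + dotp x z.
Proof. by rewrite /dotp -big_split; apply: eq_bigr => i _; rewrite mxE mulrDr. Qed.

Lemma dotpZr x a y : dotp x (a *: y) = a * dotp x y.
Proof. by rewrite /dotp mulr_sumr; apply: eq_bigr => i _; rewrite mxE mulrCA. Qed.

Lemma dotpDl x y z : dotp (x + y) z = dotp x z + dotp y z.
Proof. by rewrite dotpC dotpDr !(dotpC z). Qed.

Lemma dotpZl x a y : dotp (a *: x) y = a * dotp x y.
Proof. by rewrite dotpC dotpZr dotpC. Qed.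

Lemma dotpNr x y : dotp x (- y) = - dotp x y.
Proof. by rewrite -scaleN1r dotpZr mulN1r. Qed.

Lemma dotpNl x y : dotp (- x) y = - dotp x y.
Proof. by rewrite dotpC dotpNr dotpC. Qed.

Definition dotpE := (dotpDl, dotpDr, dotpZl, dotpZr, dotpNl, dotpNr).

Lemma dotp_ge0 x : 0 <= dotp x x.
Proof. by apply: sumr_ge0 => i _; rewrite -expr2 sqr_ge0. Qed.

Lemma enorm_ge0 x : 0 <= enorm x.
Proof. exact: sqrtr_ge0. Qed.

Lemma sqr_enorm x : enorm x ^+ 2 = dotp x x.
Proof. by rewrite sqr_sqrtr ?dotp_ge0. Qed.

Lemma enormZ a x : 0 <= a -> enorm (a *: x) = a * enorm x.
Proof.
move=> a0; rewrite /enorm !dotpE mulrA -expr2 sqrtrM ?sqr_ge0//.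
by rewrite sqrtr_sqr ger0_norm.
Qed.

Lemma enormN x : enorm (- x) = enorm x.
Proof. by rewrite /enorm !dotpE opprK. Qed.

(** Cauchy-Schwarz. Only a positive inner product needs work, and then both sides may be squared. *)
Lemma ler_dotp_enorm x y : dotp x y <= enorm x * enorm y.
Proof.
have [xy0|xy0] := leP (dotp x y) 0.
  by rewrite (le_trans xy0)// mulr_ge0// enorm_ge0.
have xyn := mulr_ge0 (enorm_ge0 x) (enorm_ge0 y).
rewrite -ler_sqr ?nnegrE// ?(ltW xy0)//.
rewrite exprMn !sqr_enorm.
(* This square expands to [dotp y y * (dotp x x * dotp y y - dotp x y ^+ 2)], which settles the case
   [dotp y y != 0]; otherwise [y] vanishes. *)
have := dotp_ge0 (dotp y y *: x - dotp x y *: y).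
rewrite !dotpE (dotpC y x).
have [y0|y0] := eqVneq (dotp y y) 0; last first.
  have : 0 < dotp y y by rewrite lt_neqAle eq_sym y0 dotp_ge0.
  nra.
suff : dotp x y <= 0 by nra.
have : forall i, y ord0 i = 0.
  move=> i; apply/eqP; rewrite -sqrf_eq0 expr2; apply/eqP.
  apply: (psumr_eq0P _ y0) => // j _; by rewrite -expr2 sqr_ge0.
by move=> yi0; rewrite /dotp big1// => i _; rewrite yi0 mulr0.
Qed.

Lemma normr_coord_le_enorm x i : `|x ord0 i| <= enorm x.
Proof.
rewrite -sqrtr_sqr ler_wsqrtr// /dotp (bigD1 i)//= -expr2 lerDl.
by apply: sumr_ge0 => j _; rewrite -expr2 sqr_ge0.
Qed.

Lemma normr_coord_le x i : `|x ord0 i| <= `|x|.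
Proof.
rewrite [leRHS]/Num.norm/= mx_normrE.
exact: (@le_bigmax _ _ _ 0 (fun ij : 'I_1 * 'I_d => `|x ij.1 ij.2|) (ord0, i)).
Qed.

(** The crude factor [d], instead of its square root, is enough for boundedness of compact sets and
    continuity of the gradient. *)
Lemma enorm_le_normr x : enorm x <= d%:R * `|x|.
Proof.
rewrite -ler_sqr ?nnegrE ?enorm_ge0 ?mulr_ge0// sqr_enorm exprMn.
apply: (@le_trans _ _ (d%:R * `|x| ^+ 2)); last first.
  rewrite ler_wpM2r ?sqr_ge0// -natrX ler_nat.
  by case: d => // n; rewrite expnS expn1 leq_pmulr.
set M := `|x| ^+ 2; rewrite mulr_natl.
have -> : M *+ d = \sum_(i < d) M by rewrite sumr_const card_ord.
rewrite ler_sum// => i _.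
rewrite -expr2 -real_normK ?num_real// ler_sqr ?nnegrE//.
exact: normr_coord_le.
Qed.

Lemma compact_enorm_bounded (A : set 'rV[R]_d) : compact A ->
  exists2 D : R, 0 <= D & forall x y, A x -> A y -> enorm (x - y) <= D.
Proof.
move=> /compact_bounded[M [_ AM]]; have M1 : M < `|M| + 1.
  by rewrite (le_lt_trans (ler_norm M))// ltrDl.
exists (d%:R * (`|M| + 1 + (`|M| + 1))) => [|x y Ax Ay]; first by rewrite mulr_ge0.
rewrite (le_trans (enorm_le_normr _))// ler_wpM2l//.
by rewrite (le_trans (ler_normB _ _))// lerD// AM.
Qed.

End euclidean_theory.

(** * Directional derivatives of smooth functions *)

Section smooth_theory.
Context {R : realType} {d : nat}.
Variables (L : R) (f : 'rV[R]_d -> R).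
Hypothesis f_smooth : smooth L f.
Implicit Types (x y v : 'rV[R]_d).

Lemma derive_grad x v : 'D_v f x = dotp (grad f x) v.
Proof.
have df := f_smooth.1 x.
rewrite deriveE// [in LHS](row_sum_delta v) linear_sum /dotp.
by apply: eq_bigr => i _; rewrite linearZ/= mxE deriveE// mulrC.
Qed.

(** The difference quotient of the restriction to the line, at [s], is that of [f] at [x + s *: v]
    in direction [v]. *)
Lemma is_derive_line x v (s : R) :
  is_derive s 1 (fun s : R => f (x + s *: v)) (dotp (grad f (x + s *: v)) v).
Proof.
have quotE : (fun h : R => h^-1 *: (f (x + (h *: 1 + s) *: v) - f (x + s *: v))) =
    (fun h : R => h^-1 *: (f (h *: v + (x + s *: v)) - f (x + s *: v))).
  by apply/funext => h; rewrite scalerDl -scalerA scale1r addrCA.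
have dfv : derivable f (x + s *: v) v := diff_derivable (f_smooth.1 _).
apply: DeriveDef; first by rewrite /derivable quotE.
by rewrite -derive_grad /derive quotE.
Qed.

(** Provides a nonnegative smoothness constant, as the later estimates multiply inequalities by
    it. *)
Lemma smooth_norm_const : smooth `|L| f.
Proof.
split; first exact: f_smooth.1.
move=> x y; rewrite (le_trans (f_smooth.2 x y))// ler_wpM2r ?enorm_ge0//.
exact: ler_norm.
Qed.

End smooth_theory.

(** * Descent and tangent inequalities *)

Section smooth_convex.
Context {R : realType} {d : nat}.
Variables (L : R) (f : 'rV[R]_d -> R).
Hypothesis L0 : 0 <= L.
Hypothesis f_smooth : smooth L f.
Implicit Types (x y v : 'rV[R]_d).

(** The mean value theorem on the segment, instead of an integral remainder, gives the constant [L]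
    where [L / 2] is usual; this affects only the final constant. *)
Lemma smooth_linearization_error x v :
  `|f (x + v) - f x - dotp (grad f x) v| <= L * enorm v ^+ 2.
Proof.
have [s] := @MVT R (fun s : R => f (x + s *: v))
  (fun s => dotp (grad f (x + s *: v)) v) 0 1 ltr01
  (fun s _ => is_derive_line f_smooth x v s)
  (@derivable_within_continuous _ _ _ _
    (fun s _ => @ex_derive _ _ _ _ _ _ _ (is_derive_line f_smooth x v s))).
rewrite in_itv/= => /andP[s0 s1].
rewrite scale0r scale1r addr0 subr0 mulr1 => ->.
(* To be applied to the difference of the two gradients in either order, one for each side of the
   absolute value. *)
have cs (u : 'rV[R]_d) : enorm u <= L * (s * enorm v) ->
    dotp u v <= L * enorm v ^+ 2.
  move=> ule; rewrite (le_trans (ler_dotp_enorm _ _))//.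
  have := enorm_ge0 v; have := enorm_ge0 u; move: ule.
  move: (enorm u) (enorm v) => a b ab a0 b0.
  apply: (@le_trans _ _ (L * (s * b) * b)); first by rewrite ler_wpM2r.
  rewrite expr2 !mulrA ler_wpM2r// ler_wpM2r// ler_piMr// ltW//.
rewrite ler_norml; apply/andP; split.
  rewrite lerNl; have -> : - (dotp (grad f (x + s *: v)) v - dotp (grad f x) v) =
      dotp (grad f x - grad f (x + s *: v)) v.
    by rewrite !dotpE; lra.
  apply: cs; rewrite (le_trans (f_smooth.2 _ _))// ler_wpM2l// opprD addNKr.
  by rewrite enormN enormZ ?(ltW s0).
rewrite -dotpNl -dotpDl; apply: cs.
rewrite (le_trans (f_smooth.2 _ _))// ler_wpM2l// addrC addKr.
by rewrite enormZ ?(ltW s0).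
Qed.

Hypothesis f_convex : convex_function [set: 'rV[R]_d] f.

(** Convexity on [[x, x + s *: v]] and the quadratic error bound leave, after division by [s], a
    defect of at most [s * K], which is arbitrarily small. *)
Lemma convex_ge_tangent x y : f x + dotp (grad f x) (y - x) <= f y.
Proof.
set v := y - x; rewrite -lerBrDl; apply/ler_addgt0Pl => e e0.
set K := L * enorm v ^+ 2.
have K0 : 0 <= K by rewrite mulr_ge0// sqr_ge0.
have [s /andP[s0 s1] sK] : exists2 s : R, 0 < s <= 1 & s * K <= e.
  (* Since [K] may be 0, [e] is added to the denominator; this also keeps [s] at most 1. *)
  exists (e / (e + K)).
    by rewrite divr_gt0 ?ltr_wpDr//= ler_pdivrMr ?ltr_wpDr// mul1r lerDl.
  by rewrite mulrAC ler_pdivrMr ?ltr_wpDr// ler_wpM2l ?(ltW e0)// lerDr (ltW e0).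
have := f_convex (Itv01 (ltW s0) s1) (mem_set I : y \in setT) (mem_set I : x \in setT).
have -> : conv (Itv01 (ltW s0) s1) (y : convex_lmodType _) (x : convex_lmodType _) = x + s *: v.
  rewrite /conv/= /v scalerBr scalerBl scale1r.
  by rewrite addrCA addrA.
have -> : conv (Itv01 (ltW s0) s1) (f y : R^o) (f x : R^o) = s * f y + (1 - s) * f x.
  by [].
have := smooth_linearization_error x (s *: v).
rewrite enormZ ?(ltW s0)// exprMn ler_norml => /andP[+ _].
rewrite dotpZr [L * _](_ : _ = s * (s * K)); last by rewrite /K; ring.
move=> h1 h2.
rewrite -(ler_pM2l s0).
have : s * (s * K) <= s * e by rewrite ler_wpM2l ?(ltW s0).
lra.
Qed.

End smooth_convex.

(** * Deterministic analysis along one sample path *)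

Lemma convex_set_comb (R : realType) (d : nat) (A : set 'rV[R]_d) (a : R)
    (x y : 'rV[R]_d) : convex_set A -> 0 <= a <= 1 -> A x -> A y ->
  A ((1 - a) *: x + a *: y).
Proof.
move=> cA /andP[a0 a1] Ax Ay.
have := cA _ _ (Itv01 a0 a1) (mem_set Ay) (mem_set Ax).
by rewrite inE /conv/= addrC.
Qed.

Section be_the_leader.
Context {R : realType} {d : nat}.
Variables (L D : R) (f : 'rV[R]_d -> R) (Omega : set 'rV[R]_d).
Hypotheses (L0 : 0 <= L) (D0 : 0 <= D).
Hypotheses (f_smooth : smooth L f) (f_convex : convex_function [set: 'rV[R]_d] f).
Hypothesis Omega_convex : convex_set Omega.
Hypothesis Omega_diam : forall x y, Omega x -> Omega y -> enorm (x - y) <= D.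
Variables (x w z g h : nat -> 'rV[R]_d).
(** The step size of iteration [k.+1]; below, [A k] is the sum of the weights 1, ..., [k], and [h k]
    stands for the minibatch gradient at [z k]. *)
Let a (k : nat) : R := 2 / (k%:R + 2).
Let A (k : nat) : R := k%:R * (k%:R + 1) / 2.
Hypotheses (x0_in : Omega (x 0%N)) (w0_in : Omega (w 0%N)).
Hypothesis zE : forall k, z k = (1 - a k) *: x k + a k *: w k.
Hypothesis gE : forall k, g k.+1 = (1 - a k) *: g k + a k *: h k.
Hypothesis wE : forall k, argmin Omega (dotp (g k.+1)) (w k.+1).
Hypothesis xE : forall k, x k.+1 = (1 - a k) *: x k + a k *: w k.+1.

Let psi (k : nat) (y : 'rV[R]_d) : R :=
  \sum_(i < k) i.+1%:R * (f (z i) + dotp (h i) (y - z i)).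

(** The two identities turn convex combinations with step [a k] into weighted sums; the bound by 2
    keeps the curvature cost of each step constant. *)
Let weights (k : nat) : [/\ A k.+1 * (1 - a k) = A k, A k.+1 * a k = k.+1%:R,
  0 <= a k <= 1, A k.+1 * a k ^+ 2 <= 2 & 0 <= A k].
Proof.
rewrite /A /a -[k.+1%:R]natr1; have : 0 <= k%:R :> R by [].
move: (k%:R : R) => n n0; have n2 : n + 2 != 0 by lra.
have n2' : 0 < n + 2 by lra.
split; [by field|by field| | |].
- by apply/andP; split; [rewrite divr_ge0// ltW|rewrite ler_pdivrMr//; lra].
- have -> : (n + 1) * (n + 1 + 1) / 2 * (2 / (n + 2)) ^+ 2 = 2 * (n + 1) / (n + 2).
    by field.
  by rewrite ler_pdivrMr//; lra.
- by rewrite divr_ge0// mulr_ge0//; lra.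
Qed.

Let w_in k : Omega (w k).
Proof. by case: k => // k; case: (wE k). Qed.

Lemma sda_iterate_in k : Omega (x k).
Proof.
elim: k => // k IH; rewrite xE.
by have [_ _ ak _ _] := weights k; exact: convex_set_comb.
Qed.

Let z_in k : Omega (z k).
Proof.
rewrite zE; have [_ _ ak _ _] := weights k.
by apply: convex_set_comb => //; exact: sda_iterate_in.
Qed.

(** The affine function [psi k] has slope [A k *: g k], so minimizing [dotp (g k)] minimizes
    [psi k]. *)
Let psi_dist k y y' : psi k y - psi k y' = A k * dotp (g k) (y - y').
Proof.
elim: k => [|k IH]; first by rewrite /psi /A !big_ord0 !mul0r subrr.
rewrite /psi !big_ord_recr/= -/(psi k y) -/(psi k y').
have [Ak Aa _ _ _] := weights k.
rewrite gE dotpDl !dotpZl.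
rewrite [RHS]mulrDr [X in _ = X + _]mulrA [X in _ = _ + X]mulrA Ak Aa.
by rewrite -IH !dotpDr !dotpNr; ring.
Qed.

Let psi_min k y : Omega y -> psi k (w k) <= psi k y.
Proof.
(* For [k = 0] both sides are empty sums. *)
case: k => [|k] Oy; first by rewrite /psi !big_ord0.
rewrite -subr_le0 psi_dist dotpE dotpNr mulr_ge0_le0//.
  by have [] := weights k.+1.
by rewrite subr_le0; case: (wE k) => _; exact.
Qed.

Let err k := h k - grad f (z k).

(** The move from [z k] to [x k.+1] is [a k *: (w k.+1 - w k)], so its quadratic cost carries
    [a k ^+ 2]. Replacing the true gradient by [h k] costs [D * enorm (err k)] times the weight. *)
Let one_step k : A k.+1 * f (x k.+1) <= A k * f (x k) +
  k.+1%:R * (f (z k) + dotp (h k) (w k.+1 - z k)) +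
  (2 * L * D ^+ 2 + D * (k.+1%:R * enorm (err k))).
Proof.
have [Ak Aa ak Aaa _] := weights k; have [a0 _] := andP ak.
have A0 : 0 <= A k.+1 by have [] := weights k.+1.
have step : x k.+1 - z k = a k *: (w k.+1 - w k).
  by rewrite xE zE opprD addrACA subrr add0r scalerBr.
have := smooth_linearization_error L0 f_smooth (z k) (x k.+1 - z k).
rewrite [z k + _]addrC subrK {2}step enormZ// exprMn ler_norml => /andP[_].
rewrite lerBlDr lerBlDr => /(ler_wpM2l A0).
set q := L * _ => hx.
have hq : A k.+1 * q <= 2 * L * D ^+ 2.
  have wD : enorm (w k.+1 - w k) ^+ 2 <= D ^+ 2.
    by rewrite ler_sqr ?nnegrE ?enorm_ge0// Omega_diam.
  have -> : A k.+1 * q = (A k.+1 * a k ^+ 2) * (L * enorm (w k.+1 - w k) ^+ 2).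
    by rewrite /q; ring.
  rewrite -[2 * L * _]mulrA ler_pM//; first by rewrite mulr_ge0// sqr_ge0.
    by rewrite mulr_ge0// sqr_ge0.
  by rewrite ler_wpM2l.
(* The [A k] part is absorbed by convexity; the other part is the new linearization in [psi]. *)
have hxz : A k.+1 * dotp (grad f (z k)) (x k.+1 - z k) =
    A k * dotp (grad f (z k)) (x k - z k) +
    k.+1%:R * dotp (grad f (z k)) (w k.+1 - z k).
  by rewrite -Ak -Aa xE !dotpE; ring.
have hconv : A k * (f (z k) + dotp (grad f (z k)) (x k - z k)) <= A k * f (x k).
  apply: ler_wpM2l; first by have [] := weights k.
  exact: (convex_ge_tangent L0 f_smooth f_convex).
have herr : - dotp (err k) (w k.+1 - z k) <= D * enorm (err k).
  rewrite -dotpNr (le_trans (ler_dotp_enorm _ _))// mulrC enormN.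
  by rewrite ler_wpM2r ?enorm_ge0// Omega_diam.
have := ler_wpM2l (ler0n R k.+1) herr.
have -> : dotp (err k) (w k.+1 - z k) =
    dotp (h k) (w k.+1 - z k) - dotp (grad f (z k)) (w k.+1 - z k).
  by rewrite /err dotpDl dotpNl.
have AkE : A k.+1 * f (z k) = A k * f (z k) + k.+1%:R * f (z k).
  by rewrite -Ak -Aa; ring.
move: hx hq hxz hconv AkE; lra.
Qed.

(* "Be the leader": [w k] minimizes [psi k], so each new linearization
   evaluated at [w k.+1] is at most the increment of [psi k (w k)]. *)
Let leader k : A k * f (x k) <=
  psi k (w k) + \sum_(i < k) (2 * L * D ^+ 2 + D * (i.+1%:R * enorm (err i))).
Proof.
elim: k => [|k IH]; first by rewrite /A !mul0r /psi !big_ord0 addr0.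
rewrite (le_trans (one_step k))// big_ord_recr/= {1}/psi big_ord_recr/=.
rewrite -/(psi k (w k.+1)).
have := psi_min k (w_in k.+1); move: IH; lra.
Qed.

Lemma sda_gap_le k y : Omega y ->
  A k * (f (x k) - f y) <=
  \sum_(i < k) (2 * L * D ^+ 2 + 2 * D * (i.+1%:R * enorm (err i))).
Proof.
(* Tangents lie below [f], and exchanging [grad f] for [h] costs the error a second time, whence the
   factor [2 * D]. *)
move=> Oy; have psiy : psi k y <= A k * f y + \sum_(i < k) D * (i.+1%:R * enorm (err i)).
  have -> : A k = \sum_(i < k) i.+1%:R.
    elim: k => [|k IH]; first by rewrite /A !mul0r big_ord0.
    rewrite big_ord_recr/= -IH /A -natr1; lra.
  rewrite mulr_suml -big_split/=; apply: ler_sum => i _.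
  rewrite mulrCA -mulrDr ler_wpM2l//.
  have := convex_ge_tangent L0 f_smooth f_convex (z i) y.
  have herr : dotp (err i) (y - z i) <= D * enorm (err i).
    rewrite (le_trans (ler_dotp_enorm _ _))// mulrC ler_wpM2r ?enorm_ge0//.
    exact: Omega_diam.
  move: herr; rewrite /err dotpDl dotpNl; lra.
rewrite mulrBr lerBlDl; apply: (le_trans (leader k)).
apply: (le_trans (lerD (psi_min k Oy) (lexx _))).
apply: (le_trans (lerD psiy (lexx _))); rewrite -addrA lerD2l -big_split/=.
by apply: ler_sum => i _; lra.
Qed.

End be_the_leader.

(** * Borel measurability of vector-valued maps *)

Section rV_measurability.
Context {R : realType} {d : nat}.

Lemma continuous_rV_measurable (phi : 'rV[R]_d -> R) :
  continuous phi -> measurable_fun [set: 'rV[R]_d] phi.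
Proof.
move=> /continuousP cphi; apply: (measurability _ (RGenOpens.measurableE R)).
move=> _ [_ [a [b ->] <-]]; rewrite setTI.
by apply: sub_sigma_algebra; exact/cphi/interval_open.
Qed.

Lemma measurable_coord (i : 'I_d) :
  measurable_fun [set: 'rV[R]_d] (fun x : 'rV[R]_d => x ord0 i).
Proof. by apply: continuous_rV_measurable => x; exact: coord_continuous. Qed.

Let rat_box (q : 'rV[rat]_d) (n : nat) : set 'rV[R]_d :=
  [set x | forall i, `|x ord0 i - ratr (q ord0 i)| < n.+1%:R^-1].

(* Second countability is what makes coordinatewise measurability imply Borel
   measurability. *)
Let open_rat_boxE (O : set 'rV[R]_d) : open O ->
  O = \bigcup_(qn in [set qn | rat_box qn.1 qn.2 `<=` O]) rat_box qn.1 qn.2.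
Proof.
move=> oO; apply/seteqP; split => [x Ox|x [qn]]; last by move=> + /=; exact.
have /nbhs_ballP[e /= e0 xeO] := open_nbhs_nbhs (conj oO Ox).
have [n ne] : exists n, n.+1%:R^-1 < e / 2.
  have /ltr_add_invr[n] : 0 < e / 2 by rewrite divr_gt0.
  by rewrite add0r; exists n.
have rat_near (i : 'I_d) : exists q : rat, `|x ord0 i - ratr q| < n.+1%:R^-1.
  have : x ord0 i - n.+1%:R^-1 < x ord0 i + n.+1%:R^-1.
    by rewrite ltrD2l gtrN.
  move=> /rat_in_itvoo[q]; rewrite in_itv/= => /andP[q1 q2].
  by exists q; rewrite distrC ltr_distl q1.
have /choice[q qx] := rat_near.
exists (\row_i q i, n) => /=; last by move=> i; rewrite mxE.
move=> y yb; apply: xeO; split => // i j; rewrite (ord1 i).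
have := yb j; have := qx j; rewrite mxE /ball/= => xq yq.
rewrite (le_lt_trans (ler_distD (ratr (q j)) _ _))// [e]splitr.
by rewrite ltrD//; [exact: lt_trans xq ne|rewrite distrC; exact: lt_trans yq ne].
Qed.

(** An open set is a countable union of rational boxes, and the preimage of a box is a finite
    intersection of coordinate preimages. *)
Lemma measurable_fun_rV (dT : measure_display) (T : measurableType dT)
    (u : T -> 'rV[R]_d) :
  (forall i, measurable_fun [set: T] (fun t => u t ord0 i)) ->
  measurable_fun [set: T] u.
Proof.
move=> mu; apply: (measurability (@open 'rV[R]_d)) => // _ [U oU <-].
rewrite setTI (open_rat_boxE oU) preimage_bigcup bigcup_mkcond.
apply: countable_bigcupT_measurable => [|[q n]]; first exact: countableP.
case: ifPn => // _.
have -> : u @^-1` rat_box q n = \bigcap_(i in [set: 'I_d])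
    ((fun t => u t ord0 i) @^-1` ball (ratr (q ord0 i) : R) n.+1%:R^-1).
  apply/seteqP; split => t /=.
    by move=> ut i _; rewrite /ball/= distrC; exact: ut.
  by move=> ut i; rewrite distrC; exact: (ut i I).
apply: fin_bigcap_measurable => // i _; rewrite -[X in measurable X]setTI.
by apply: mu => //; apply: open_measurable; exact: ball_open.
Qed.

Section vector_operations.
Context {dT : measure_display} {T : measurableType dT}.
Implicit Types (u v : T -> 'rV[R]_d).

Lemma measurable_fun_rVP u : measurable_fun [set: T] u <->
  forall i, measurable_fun [set: T] (fun t => u t ord0 i).
Proof.
split=> [mu i|]; last exact: measurable_fun_rV.
exact: (measurableT_comp (measurable_coord i) mu).
Qed.

Lemma measurable_funZ_rV (a : R) u :
  measurable_fun [set: T] u -> measurable_fun [set: T] (fun t => a *: u t).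
Proof.
move=> /measurable_fun_rVP mu; apply/measurable_fun_rVP => i.
under eq_fun do rewrite mxE.
exact: measurable_funM.
Qed.

Lemma measurable_funD_rV u v :
  measurable_fun [set: T] u -> measurable_fun [set: T] v ->
  measurable_fun [set: T] (fun t => u t + v t).
Proof.
move=> /measurable_fun_rVP mu /measurable_fun_rVP mv; apply/measurable_fun_rVP => i.
under eq_fun do rewrite mxE.
exact: measurable_funD.
Qed.

Lemma measurable_sum_rV (I : Type) (s : seq I) (u : I -> T -> 'rV[R]_d) :
  (forall j, measurable_fun [set: T] (u j)) ->
  measurable_fun [set: T] (fun t => \sum_(j <- s) u j t).
Proof.
move=> mu; apply/measurable_fun_rVP => i.
under eq_fun do rewrite summxE.
by apply: measurable_sum => j; move/measurable_fun_rVP : (mu j); exact.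
Qed.

Lemma measurable_fun_enorm u :
  measurable_fun [set: T] u -> measurable_fun [set: T] (fun t => enorm (u t)).
Proof.
move=> /measurable_fun_rVP mu.
apply: (measurableT_comp (continuous_measurable_fun (@sqrt_continuous R))).
by apply: measurable_sum => i; exact: measurable_funM.
Qed.

End vector_operations.

Lemma measurable_grad (L : R) (f : 'rV[R]_d -> R) : smooth L f ->
  measurable_fun [set: 'rV[R]_d] (grad f).
Proof.
move=> /smooth_norm_const f_smooth; apply/measurable_fun_rVP => i.
apply: continuous_rV_measurable => x.
move=> U /nbhs_ballP[e /= e0 eU].
(* A Lipschitz constant for the sup norm, increased by 1 to be positive. *)
have K0 : 0 < `|L| * d%:R + 1 by rewrite ltr_wpDl// mulr_ge0.
apply/nbhs_ballP; exists (e / (`|L| * d%:R + 1)) => /=; first by rewrite divr_gt0.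
move=> y; rewrite -ball_normE/= ltr_pdivlMr// => xy; apply: eU.
have := normr_coord_le_enorm (grad f x - grad f y) i.
rewrite /ball/= !mxE => /le_lt_trans; apply; apply: le_lt_trans xy.
rewrite (le_trans (f_smooth.2 _ _))// mulrDr mulr1 mulrCA ler_wpDr//.
by rewrite ler_wpM2l// mulrC enorm_le_normr.
Qed.

End rV_measurability.

(** * Independence, the sample filtration and the minibatch error *)

(** Under independence the joint law agrees with the product law on rectangles, hence everywhere;
    Tonelli then allows [X] to be frozen in the inner integral. *)
Lemma independent_integral_le {R : realType} {d d1 d2 : measure_display}
    {T : measurableType d} {T1 : measurableType d1} {T2 : measurableType d2}
    (Pr : probability T R) (X : {RV Pr >-> T1}) (Y : {RV Pr >-> T2})
    (h : T1 * T2 -> \bar R) (c : \bar R) :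
  (forall A B, measurable A -> measurable B ->
    Pr (X @^-1` A `&` Y @^-1` B) = (Pr (X @^-1` A) * Pr (Y @^-1` B))%E) ->
  measurable_fun [set: T1 * T2] h -> (forall xy, 0 <= h xy)%E ->
  (forall x, \int[Pr]_t h (x, Y t) <= c)%E ->
  (\int[Pr]_t h (X t, Y t) <= c)%E.
Proof.
move=> XY mh h0 hc.
have mXY : measurable_fun [set: T] (fun t => (X t, Y t)).
  by apply: measurable_fun_pair.
pose m1 := distribution Pr X; pose m2 := distribution Pr Y.
pose XYfun : {mfun T >-> (T1 * T2)%type} := HB.pack (fun t => (X t, Y t))
  (isMeasurableFun.Build _ _ _ _ _ mXY).
pose m := distribution Pr (XYfun : {RV Pr >-> (T1 * T2)%type}).
have mE Z : measurable Z -> (m1 \x m2)%E Z = m Z.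
  by move=> mZ; apply: (product_measure_unique (m' := m)).
have c0 : (0 <= c)%E by rewrite (le_trans _ (hc point))// integral_ge0.
suff : (\int[m]_xy h xy <= c)%E by rewrite ge0_integral_distribution.
rewrite (eq_measure_integral (m1 \x m2)%E); last by move=> Z mZ _; apply/esym/mE.
rewrite fubini_tonelli1//.
apply: (@le_trans _ _ (\int[m1]_x cst c x)%E).
  apply: ge0_le_integral => //.
  - by move=> x _; exact: integral_ge0.
  - exact: measurable_fun_fubini_tonelli_F.
  - move=> x _; rewrite /fubini_F ge0_integral_distribution//; first exact: hc.
    exact: measurable_fun_pair2.
rewrite integral_cst// [X in (c * X)%E](_ : _ = 1%E) ?mule1//.
exact: (probability_setT (distribution Pr X)).
Qed.

Section sampling_theory.
Context {dT dS : measure_display} {T : measurableType dT}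
  {S : measurableType dS} {R : realType} {d : nat}.
Variables (Pr : probability T R) (p : nat -> nat).
Variable xi : nat -> nat -> {RV Pr >-> S}.

(** The generators are named apart from the sigma-algebra so that [g_sigma_algebraType] can make [T]
    a measurable type for it. *)
Definition history_gen (k : nat) : set (set T) :=
  \bigcup_(i in [set i | (1 <= i <= k)%N]) \bigcup_(j in `I_(p i))
    preimage_set_system [set: T] (xi i j) measurable.

Definition batch_gen (k : nat) : set (set T) :=
  \bigcup_(j in `I_(p k)) preimage_set_system [set: T] (xi k j) measurable.

Definition adapted (k : nat) (u : T -> 'rV[R]_d) : Prop :=
  measurable_fun [set: g_sigma_algebraType (history_gen k)] u.

Let sample_preimage_measurable i j A :
  preimage_set_system [set: T] (xi i j) measurable A -> measurable A.
Proof. by move=> [B mB <-]; apply: measurable_funPT. Qed.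

Lemma history_measurable k A : history p xi k A -> measurable A.
Proof.
apply: smallest_sub; first exact: sigma_algebra_measurable.
by move=> B [i _ [j _ /sample_preimage_measurable]].
Qed.

Lemma batch_sigma_measurable k A : batch_sigma p xi k A -> measurable A.
Proof.
apply: smallest_sub; first exact: sigma_algebra_measurable.
by move=> B [j _ /sample_preimage_measurable].
Qed.

Lemma adapted_measurable k (u : T -> 'rV[R]_d) :
  adapted k u -> measurable_fun [set: T] u.
Proof.
move=> uk _ A mA; apply: (@history_measurable k).
exact: (uk measurableT A mA).
Qed.

Lemma adaptedS k (u : T -> 'rV[R]_d) : adapted k u -> adapted k.+1 u.
Proof.
move=> uk _ A mA; have := uk measurableT A mA.
apply: sub_sigma_algebra2 => B [i /= /andP[i1 ik] Bi]; exists i => //=.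
by rewrite i1 (leq_trans ik).
Qed.

Lemma adapted_comb k (a b : R) (u v : T -> 'rV[R]_d) :
  adapted k u -> adapted k v -> adapted k (fun t => a *: u t + b *: v t).
Proof. by move=> ? ?; apply: measurable_funD_rV; exact: measurable_funZ_rV. Qed.

(** Measurability in the sample point is with respect to the batch alone, as independence from the
    past demands. *)
Lemma measurable_minibatch k (G : 'rV[R]_d -> S -> 'rV[R]_d) :
  measurable_fun [set: 'rV[R]_d * S] (fun xs : 'rV[R]_d * S => G xs.1 xs.2) ->
  measurable_fun [set: 'rV[R]_d * g_sigma_algebraType (batch_gen k)]
    (fun yt : 'rV[R]_d * g_sigma_algebraType (batch_gen k) =>
      minibatch G p xi k yt.1 yt.2).
Proof.
move=> mG; apply: measurable_funZ_rV; apply: measurable_sum_rV => j.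
apply: (measurableT_comp mG
  (g := fun yt : _ * g_sigma_algebraType (batch_gen k) => (yt.1, xi k j yt.2))).
apply: measurable_fun_pair => //.
suff mxi : measurable_fun [set: g_sigma_algebraType (batch_gen k)] (xi k j).
  exact: measurableT_comp mxi _.
move=> _ A mA; apply: sub_sigma_algebra.
by exists j => /=; [exact: ltn_ord|exists A].
Qed.

Lemma minibatch_error_le (P : probability S R) (G : 'rV[R]_d -> S -> 'rV[R]_d)
    (L c : R) (f : 'rV[R]_d -> R) (k : nat) (z : T -> 'rV[R]_d) :
  smooth L f -> fresh_iid_samples P p xi ->
  measurable_fun [set: 'rV[R]_d * S] (fun xs : 'rV[R]_d * S => G xs.1 xs.2) ->
  adapted k z ->
  (forall y, 'E_Pr[fun t => enorm (minibatch G p xi k.+1 y t - grad f y)]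
     <= c%:E)%E ->
  measurable_fun [set: T]
    (fun t => enorm (minibatch G p xi k.+1 (z t) t - grad f (z t))) /\
  ('E_Pr[fun t => enorm (minibatch G p xi k.+1 (z t) t - grad f (z t))]
     <= c%:E)%E.
Proof.
move=> f_smooth fresh mG zk hc.
pose T2 := g_sigma_algebraType (batch_gen k.+1).
have mz := adapted_measurable zk.
(* The identity into [T] with the batch sigma-algebra serves as the random variable carrying the
   whole batch. *)
have mY : measurable_fun [set: T] (id : T -> T2).
  by move=> _ A mA; rewrite setTI; exact: batch_sigma_measurable mA.
pose X : {mfun T >-> 'rV[R]_d} := HB.pack z
  (isMeasurableFun.Build _ _ _ _ _ mz).
pose Y : {mfun T >-> T2} := HB.pack (id : T -> T2)
  (isMeasurableFun.Build _ _ _ _ _ mY).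
pose err (yt : 'rV[R]_d * T2) := enorm (minibatch G p xi k.+1 yt.1 yt.2 - grad f yt.1).
have merr : measurable_fun [set: 'rV[R]_d * T2] err.
  apply: measurable_fun_enorm.
  under eq_fun do rewrite -scaleN1r.
  apply: measurable_funD_rV; first exact: measurable_minibatch.
  by apply: measurable_funZ_rV; apply: (measurableT_comp (measurable_grad f_smooth)).
split.
  apply: (measurableT_comp merr (g := fun t => (z t, t : T2))).
  exact: measurable_fun_pair.
rewrite unlock.
apply: (@independent_integral_le R _ _ _ T _ T2 Pr X Y (EFin \o err)).
(* Freshness at [k.+1] concerns the history up to [k], to which [z] is adapted. *)
- move=> A B mA mB; apply: (sample_fresh fresh (k := k.+1)) => //=.
  by have := zk measurableT A mA; rewrite setTI.
- exact/measurable_EFinP.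
- by move=> yt; rewrite lee_fin enorm_ge0.
- by move=> y; have := hc y; rewrite unlock.
Qed.

End sampling_theory.

(** * Expectation of the pathwise bound and the rate *)

Lemma integral_affine_le {dT : measure_display} {T : measurableType dT}
    {R : realType} (Pr : probability T R) (u : T -> R) (a b c : R) :
  0 <= a -> 0 <= b -> measurable_fun [set: T] u -> (forall t, 0 <= u t) ->
  ('E_Pr[u] <= c%:E)%E -> (\int[Pr]_t (a + b * u t)%:E <= (a + b * c)%:E)%E.
Proof.
move=> a0 b0 mu u0; rewrite unlock => uc.
under eq_integral do rewrite EFinD EFinM.
rewrite ge0_integralD//; last 2 first.
- by move=> t _; rewrite -EFinM lee_fin mulr_ge0.
- by apply: measurable_funeM; exact/measurable_EFinP.
rewrite ge0_integralZl//; last 2 first.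
- exact/measurable_EFinP.
- by move=> t _; rewrite lee_fin.
rewrite integral_cst// [X in (_ * X)%E]probability_setT mule1.
by rewrite EFinD EFinM leeD2l// lee_wpmul2l.
Qed.

Theorem theorem1 (R : realType) (d : nat)
  (dT dS : measure_display) (T : measurableType dT) (S : measurableType dS)
  (Pr : probability T R) (P : probability S R)
  (Omega : set 'rV[R]_d)
  (Omega_nonempty : Omega !=set0)
  (Omega_compact : compact Omega)
  (Omega_convex : convex_set Omega)
  (F : 'rV[R]_d -> S -> R) (f : 'rV[R]_d -> R) (L : R)
  (f_mean : is_mean_of P F f)
  (f_convex : convex_function [set: 'rV[R]_d] f)
  (f_smooth : smooth L f)
  (G : 'rV[R]_d -> S -> 'rV[R]_d)
  (G_oracle : unbiased_oracle P G f)
  (xstar : 'rV[R]_d)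
  (xstar_min : argmin Omega f xstar)
  (alpha beta : nat -> R) (p : nat -> nat)
  (xi : nat -> nat -> {RV Pr >-> S})
  (x0 : 'rV[R]_d) (x w z g : nat -> T -> 'rV[R]_d)
  (algo : FW_SDA P Omega f G alpha beta p xi x0 x w z g)
  (alpha_def : forall k : nat, (1 <= k)%N -> alpha k = 2 / (k%:R + 1))
  (alpha_beta : forall k : nat, (1 <= k)%N ->
    alpha k = beta k / \sum_(1 <= i < k.+1) beta i)
  (p_spec : forall (k : nat) (y : 'rV[R]_d), (1 <= k)%N ->
    ('E_Pr[fun t => enorm (minibatch G p xi k y t - grad f y)] <=
       (1 / k%:R)%:E)%E) :
  exists C : R, forall k : nat, (1 <= k)%N ->
    ('E_Pr[fun t => (f (x k t) - f xstar)%R] <= (C / k%:R)%:E)%E.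
Proof.
case: algo => x0_in B0 _ fresh xE0 [w0 [w0_in _] wE0] gE0 zE gE wE w_meas xE.
have L0 : 0 <= `|L| by [].
have f_smooth' := smooth_norm_const f_smooth.
have [D D0 diam] := compact_enorm_bounded Omega_compact.
have aE k : alpha k.+1 = 2 / (k%:R + 2).
  by rewrite alpha_def// -[k.+1%:R]natr1 -addrA.
(* As [alpha] is the ratio of [beta] to its partial sum, the dual average is a convex combination
   with the same step as the iterates. *)
have gE' k t : g k.+1 t = (1 - alpha k.+1) *: g k t +
    alpha k.+1 *: minibatch G p xi k.+1 (z k t) t.
  have Bk0 : beta_sum beta k.+1 != 0 by exact: B0.
  have BS : beta_sum beta k.+1 = beta_sum beta k + beta k.+1.
    by rewrite /beta_sum big_nat_recr.
  have -> : alpha k.+1 = beta k.+1 / beta_sum beta k.+1 by exact: alpha_beta.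
  rewrite gE scalerDr !scalerA [in LHS]mulrC [_^-1 * beta _]mulrC.
  by congr (_ *: _ + _); rewrite -[1](divff Bk0) -mulrBl {2}BS addrK.
(* The start is deterministic, and each [w k.+1] is a measurable selection for the history. *)
have x_adapted k : adapted p xi k (x k) /\ adapted p xi k (w k).
  elim: k => [|k [xk wk]].
    split; first by rewrite (_ : x 0%N = cst x0); [exact: measurable_cst|exact/funext].
    by rewrite (_ : w 0%N = cst w0); [exact: measurable_cst|exact/funext].
  have wk1 : adapted p xi k.+1 (w k.+1).
    by move=> _ A mA; apply: w_meas; exists A.
  split => //; rewrite (funext (xE k)).
  by apply: adapted_comb => //; exact: adaptedS.
have z_adapted k : adapted p xi k (z k).
  by rewrite (funext (zE k)); have [] := x_adapted k; exact: adapted_comb.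
pose err k t := enorm (minibatch G p xi k.+1 (z k t) t - grad f (z k t)).
have err_le k := minibatch_error_le (c := 1 / k.+1%:R) f_smooth fresh
  (oracle_measurable G_oracle) (z_adapted k) (fun y => p_spec k.+1 y isT).
have w0_in' t : Omega (w 0%N t) by rewrite wE0.
have x0_in' t : Omega (x 0%N t) by rewrite xE0.
have x_in k t : Omega (x k t).
  apply: (@sda_iterate_in _ _ Omega Omega_convex (x ^~ t) (w ^~ t) (g ^~ t)) => //.
  by move=> j; rewrite xE aE.
have gap k t : k%:R * (k%:R + 1) / 2 * (f (x k t) - f xstar) <=
    \sum_(i < k) (2 * `|L| * D ^+ 2 + 2 * D * (i.+1%:R * err i t)).
  apply: (@sda_gap_le _ _ `|L| D f Omega L0 D0 f_smooth' f_convex Omega_convex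
    diam (x ^~ t) (w ^~ t) (z ^~ t) (g ^~ t)
    (fun i => minibatch G p xi i.+1 (z i t) t)) => //.
  - by move=> j; rewrite zE aE.
  - by move=> j; rewrite gE' aE.
  - by move=> j; rewrite xE aE.
  - by case: xstar_min.
pose c1 := 2 * `|L| * D ^+ 2; pose c2 := 2 * D.
have c10 : 0 <= c1 by rewrite /c1 !mulr_ge0// sqr_ge0.
have c20 : 0 <= c2 by rewrite /c2 mulr_ge0.
(* From [k * (c1 + c2) / A = 2 * (c1 + c2) / (k + 1)], with [A = k * (k + 1) / 2]. *)
exists (2 * (c1 + c2)) => k k1.
have kR : 0 < k%:R :> R by rewrite ltr0n.
pose A : R := k%:R * (k%:R + 1) / 2.
have A0 : 0 < A by rewrite /A divr_gt0// mulr_gt0// addr_gt0.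
have A1 : 0 <= A^-1 by rewrite invr_ge0 ltW.
pose term i t := A^-1 * c1 + A^-1 * c2 * i.+1%:R * err i t.
have mterm i : measurable_fun [set: T] (term i).
  apply: measurable_funD => //; apply: measurable_funM => //.
  by have [] := err_le i.
have term0 i t : 0 <= term i t.
  by rewrite /term addr_ge0// ?mulr_ge0 ?enorm_ge0.
(* The weight [i.+1] cancels against the expected error bound [1 / i.+1], so every term has the same
   bound. *)
have intterm i : (\int[Pr]_t (term i t)%:E <= (A^-1 * (c1 + c2))%:E)%E.
  have [merr Eerr] := err_le i.
  have -> : A^-1 * (c1 + c2) = A^-1 * c1 + A^-1 * c2 * i.+1%:R * (1 / i.+1%:R).
    by rewrite div1r mulfK// mulrDr.
  apply: integral_affine_le => //.
  - by rewrite mulr_ge0.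
  - by rewrite !mulr_ge0.
  - by move=> t; rewrite enorm_ge0.
rewrite unlock.
apply: (@le_trans _ _ (\int[Pr]_t (\sum_(i < k) (term i t)%:E))%E).
  apply: ge0_le_integral => //.
  (* The gap is nonnegative because [x k t] stays in [Omega]. *)
  - by move=> t _; rewrite lee_fin subr_ge0; case: xstar_min => _; exact.
  - apply/measurable_EFinP; apply: measurable_funB => //.
    apply: measurableT_comp; last exact: adapted_measurable (x_adapted k).1.
    apply: continuous_rV_measurable => y.
    exact: differentiable_continuous (f_smooth.1 y).
  - by apply: emeasurable_sum => i; exact/measurable_EFinP.
  - move=> t _; rewrite sumEFin lee_fin -(ler_pM2l A0) (le_trans (gap k t))//.
    rewrite mulr_sumr ler_sum// => i _; rewrite /term mulrDr !mulrA divff ?gt_eqF//.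
    by rewrite !mul1r.
rewrite ge0_integral_sum//; last 2 first.
- by move=> i; exact/measurable_EFinP.
- by move=> i t _; rewrite lee_fin.
apply: (@le_trans _ _ (\sum_(i < k) (A^-1 * (c1 + c2))%:E)%E); first exact: lee_sum.
rewrite sumEFin lee_fin sumr_const card_ord -(mulr_natl (A^-1 * (c1 + c2))).
have -> : k%:R * (A^-1 * (c1 + c2)) = 2 * (c1 + c2) / (k%:R + 1).
  by rewrite /A; field; rewrite !gt_eqF// addr_gt0.
apply: ler_wpM2l; first by rewrite mulr_ge0// addr_ge0.
by rewrite lef_pV2 ?posrE ?addr_gt0// lerDl.
Qed.
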